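(* Let $\mathfrak{g}$ be a Borel subalgebra of the complex simple Lie algebra of type $F_4$, with simple roots $\alpha_1,\alpha_2,\alpha_3,\alpha_4$. Write $X_{abcd}$ for a nonzero root vector of the positive root $a\alpha_1+b\alpha_2+c\alpha_3+d\alpha_4$. Then $\mathfrak{g}$ has exactly 16 abelian ideals, namely: 1. $0$ 2. $\langle X_{2342}\rangle$ 3. $\langle X_{1342},X_{2342}\rangle$ 4. $\langle X_{1242},X_{1342},X_{2342}\rangle$ 5. $\langle X_{1232},X_{1242},X_{1342},X_{2342}\rangle$ 6. $\langle X_{1222},X_{1232},X_{1242},X_{1342},X_{2342}\rangle$ 7. $\langle X_{1231},X_{1232},X_{1242},X_{1342},X_{2342}\rangle$ 8. $\langle X_{1122},X_{1222},X_{1232},X_{1242},X_{1342},X_{2342}\rangle$ 9. $\langle X_{1222},X_{1231},X_{1232},X_{1242},X_{1342},X_{2342}\rangle$ 10. $\langle X_{0122},X_{1122},X_{1222},X_{1232},X_{1242},X_{1342},X_{2342}\rangle$ 11. $\langle X_{1122},X_{1222},X_{1231},X_{1232},X_{1242},X_{1342},X_{2342}\rangle$ 12. $\langle X_{1221},X_{1222},X_{1231},X_{1232},X_{1242},X_{1342},X_{2342}\rangle$ 13. $\langle X_{1220},X_{1221},X_{1222},X_{1231},X_{1232},X_{1242},X_{1342},X_{2342}\rangle$ 14. $\langle X_{0122},X_{1122},X_{1222},X_{1231},X_{1232},X_{1242},X_{1342},X_{2342}\rangle$ 15. $\langle X_{1122},X_{1221},X_{1222},X_{1231},X_{1232},X_{1242},X_{1342},X_{2342}\rangle$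 16. $\langle X_{0122},X_{1122},X_{1221},X_{1222},X_{1231},X_{1232},X_{1242},X_{1342},X_{2342}\rangle$
   Context: The Borel subalgebra is $\mathfrak{g}=T\oplus\sum_{\alpha\in R^+}\mathbb{C}X_\alpha$, where $T$ is a Cartan subalgebra and $R^+$ is the set of positive roots determined by the simple roots. The simple roots of $F_4$ are numbered so that the Dynkin diagram is the chain $\alpha_1 - \alpha_2 \Rightarrow \alpha_3 - \alpha_4$ with $\alpha_1,\alpha_2$ long and $\alpha_3,\alpha_4$ short; the highest root is then $2\alpha_1+3\alpha_2+4\alpha_3+2\alpha_4$. Angle brackets denote complex linear span. *)

(* Defs.v *)
From HB Require Import structures.
From mathcomp Require Import all_boot all_order all_algebra.
From mathcomp Require Export complex.
From mathcomp Require Import all_classical all_reals.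

Set Implicit Arguments.
Unset Strict Implicit.
Unset Printing Implicit Defensive.

Import GRing.Theory.
Local Open Scope classical_set_scope.
Local Open Scope ring_scope.

(** MathComp has no Lie algebras: a finite-dimensional Lie algebra over [K] is
    a [vectType] together with a bracket. *)
Record lieBracket (K : fieldType) (L : vectType K) := LieBracket {
  lie_fun :> L -> L -> L;
  lie_linearr : forall x, linear (lie_fun x);
  lie_linearl : forall y, linear (fun x => lie_fun x y);
  lie_xx : forall x, lie_fun x x = 0;
  lie_jacobi : forall x y z,
    lie_fun x (lie_fun y z) + lie_fun y (lie_fun z x)
      + lie_fun z (lie_fun x y) = 0 }.

Definition lie_ad (K : fieldType) (L : vectType K) (br : lieBracket L) (x : L) :
  'End(L) := linfun (br x).

(** The linear span of the brackets [br x y], [x \in U], [y \in V]; by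
    bilinearity it suffices to let [x] and [y] range over bases. *)
Definition lie_prod (K : fieldType) (L : vectType K) (br : lieBracket L)
  (U V : {vspace L}) : {vspace L} :=
  <<[seq br x y | x <- vbasis U, y <- vbasis V]>>%VS.

Definition lie_abelian (K : fieldType) (L : vectType K) (br : lieBracket L)
  (U : {vspace L}) : Prop :=
  forall x y, x \in U -> y \in U -> br x y = 0.

(** [I] is an ideal of the subalgebra [g]. *)
Definition lie_ideal (K : fieldType) (L : vectType K) (br : lieBracket L)
  (g I : {vspace L}) : Prop :=
  (I <= g)%VS /\ (forall x y, x \in g -> y \in I -> br x y \in I).

Definition lie_simple (K : fieldType) (L : vectType K) (br : lieBracket L) :
  Prop :=
  ~ lie_abelian br fullv /\
  (forall I : {vspace L}, lie_ideal br fullv I -> I = 0%VS \/ I = fullv).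

Definition ad_diagonalizable (K : fieldType) (L : vectType K)
  (br : lieBracket L) (x : L) : Prop :=
  exists2 e : seq L, basis_of fullv e &
    forall v, v \in e -> exists c : K, br x v = c *: v.

(** Cartan subalgebra of a semisimple Lie algebra over an algebraically closed
    field of characteristic 0: abelian, equal to its own centralizer, and acting
    by diagonalizable endomorphisms in the adjoint representation. *)
Definition cartan_subalgebra (K : fieldType) (L : vectType K)
  (br : lieBracket L) (T : {vspace L}) : Prop :=
  [/\ lie_abelian br T,
      forall x, (forall h, h \in T -> br h x = 0) -> x \in T &
      forall h, h \in T -> ad_diagonalizable br h].

(** The space of all [x] with [[h, x] = a(h) x] for every [h] in [T]; see
    [root_spaceP]. *)
Definition root_space (K : fieldType) (L : vectType K) (br : lieBracket L)
  (T : {vspace L}) (a : 'Hom(subvs_of T, K^o)) : {vspace L} :=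
  let e := vbasis (fullv : {vspace subvs_of T}) in
  (\bigcap_(i < \dim (fullv : {vspace subvs_of T}))
     lker (lie_ad br (vsval e`_i) - (a e`_i : K) *: \1%VF))%VS.

Definition is_root (K : fieldType) (L : vectType K) (br : lieBracket L)
  (T : {vspace L}) (a : 'Hom(subvs_of T, K^o)) : Prop :=
  a != 0 /\ root_space br a != 0%VS.

Definition root_vector (K : fieldType) (L : vectType K) (br : lieBracket L)
  (T : {vspace L}) (a : 'Hom(subvs_of T, K^o)) (x : L) : Prop :=
  x \in root_space br a /\ x != 0.

Definition natcomb (V : nmodType) (n : nat) (al : n.-tuple V)
  (m : n.-tuple nat) : V :=
  \sum_(i < n) tnth al i *+ tnth m i.

(** [al] is a system of simple roots. *)
Definition simple_roots (K : fieldType) (L : vectType K) (br : lieBracket L)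
  (T : {vspace L}) (n : nat) (al : n.-tuple 'Hom(subvs_of T, K^o)) : Prop :=
  [/\ forall i, is_root br (tnth al i),
      free al &
      forall b : 'Hom(subvs_of T, K^o), is_root br b ->
        exists m : n.-tuple nat, b = natcomb al m \/ b = - natcomb al m].

Definition pos_roots (K : fieldType) (L : vectType K) (br : lieBracket L)
  (T : {vspace L}) (n : nat) (al : n.-tuple 'Hom(subvs_of T, K^o)) :
  set 'Hom(subvs_of T, K^o) :=
  [set b | is_root br b /\ exists m : n.-tuple nat, b = natcomb al m].

(** [T] plus the sum of the positive root spaces. The set of roots is finite, as
    [L] is finite-dimensional, so this [\big] over a set is the actual sum. *)
Definition borel (K : fieldType) (L : vectType K) (br : lieBracket L)
  (T : {vspace L}) (n : nat) (al : n.-tuple 'Hom(subvs_of T, K^o)) :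
  {vspace L} :=
  (T + \big[@addv K L/0%VS]_(b \in pos_roots br al) root_space br b)%VS.

(** The coroot of a root [a]: the [h] in [T] lying in [[L_a, L_(-a)]] with
    [a(h) = 2]. The Cartan integer <b, a> = 2(b, a)/(a, a) is then [b(h)]. *)
Definition is_coroot (K : fieldType) (L : vectType K) (br : lieBracket L)
  (T : {vspace L}) (a : 'Hom(subvs_of T, K^o)) (h : subvs_of T) : Prop :=
  vsval h \in lie_prod br (root_space br a) (root_space br (- a)) /\
  a h = 2%:R.

(** Cartan integers <a_i, a_j> = 2(a_i, a_j)/(a_j, a_j) of the diagram
    a_1 - a_2 => a_3 - a_4, with a_1, a_2 long: <a_2, a_3> = -2 and
    <a_3, a_2> = -1. *)
Definition cartanF4 (i j : 'I_4) : int :=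
  nth 0 (nth [::] [:: [::  2; -1;  0;  0];
                      [:: -1;  2; -2;  0];
                      [::  0; -1;  2; -1];
                      [::  0;  0; -1;  2]] i) j.

Definition type_F4 (K : fieldType) (L : vectType K) (br : lieBracket L)
  (T : {vspace L}) (al : 4.-tuple 'Hom(subvs_of T, K^o)) : Prop :=
  exists h : 'I_4 -> subvs_of T,
    (forall j, is_coroot br (tnth al j) (h j)) /\
    (forall i j, tnth al i (h j) = (cartanF4 i j)%:~R).

Lemma lie_sumr (K : fieldType) (L : vectType K) (br : lieBracket L) (x : L)
  (n : nat) (c : 'I_n -> K) (y : 'I_n -> L) :
  br x (\sum_i c i *: y i) = \sum_i c i *: br x (y i).
Proof.
pose f := GRing.isLinear.Build K L L *:%R (br x) (lie_linearr br x).
pose g : {linear L -> L} := HB.pack (br x : L -> L) f.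
rewrite -[br x]/(g : L -> L) linear_sum.
by apply: eq_bigr => i _; rewrite linearZ.
Qed.

Lemma lie_suml (K : fieldType) (L : vectType K) (br : lieBracket L) (y : L)
  (n : nat) (c : 'I_n -> K) (x : 'I_n -> L) :
  br (\sum_i c i *: x i) y = \sum_i c i *: br (x i) y.
Proof.
pose f := GRing.isLinear.Build K L L *:%R (fun z => br z y) (lie_linearl br y).
pose g : {linear L -> L} := HB.pack (fun z => br z y) f.
rewrite -[br _ y]/(g _) linear_sum.
by apply: eq_bigr => i _; rewrite linearZ.
Qed.

Lemma lie_adE (K : fieldType) (L : vectType K) (br : lieBracket L) (x y : L) :
  lie_ad br x y = br x y.
Proof.
pose f := GRing.isLinear.Build K L L *:%R (br x) (lie_linearr br x).
pose g : {linear L -> L} := HB.pack (br x : L -> L) f.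
exact: (lfunE g).
Qed.

Lemma lie_prodP (K : fieldType) (L : vectType K) (br : lieBracket L)
  (U V W : {vspace L}) :
  (lie_prod br U V <= W)%VS <->
  (forall x y, x \in U -> y \in V -> br x y \in W).
Proof.
split=> [/span_subvP UVW x y xU yV|UVW]; last first.
  apply/span_subvP => _ /allpairsP[[x y] /= [xU yV ->]].
  by apply: UVW; apply: vbasis_mem.
rewrite (coord_vbasis yV) lie_sumr; apply: memv_suml => j _.
rewrite (coord_vbasis xU) lie_suml; apply/memvZ/memv_suml => i _.
apply/memvZ/UVW/allpairsP.
exists ((vbasis U)`_i, (vbasis V)`_j) => /=.
by split=> //; apply: mem_nth; rewrite size_tuple.
Qed.

Lemma root_spaceP (K : fieldType) (L : vectType K) (br : lieBracket L)
  (T : {vspace L}) (a : 'Hom(subvs_of T, K^o)) (x : L) :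
  x \in root_space br a <->
  (forall h : subvs_of T, br (vsval h) x = (a h : K) *: x).
Proof.
have kerE (h : subvs_of T) :
    (x \in lker (lie_ad br (vsval h) - (a h : K) *: \1%VF)) =
    (br (vsval h) x == (a h : K) *: x).
  by rewrite memv_ker !lfun_simp lie_adE subr_eq0.
split=> [xa h|xa]; last first.
  rewrite memvE; apply/subv_bigcapP => i _.
  by rewrite -memvE kerE xa.
rewrite (coord_vbasis (memvf h)) !linear_sum scaler_suml /=.
rewrite lie_suml.
apply: eq_bigr => i _; rewrite linearZ -scalerA; congr (_ *: _).
apply/eqP; rewrite -kerE; move: xa; rewrite !memvE => xa.
by apply: (subv_trans xa); apply: (bigcapv_inf i).
Qed.

(* Main.v *)
Require Import Defs.
From mathcomp Require Import all_boot all_order all_algebra.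
From mathcomp Require Import all_classical all_reals.
From mathcomp Require Import zify ring.

(** For a simple root [a] with coroot [h], pick [e] and [f] in the root spaces of
    [a] and [- a] with [[e, f] = h].  Elementary [sl_2] theory (no Killing form)
    shows that root spaces of simple roots are lines, that dimensions of root
    spaces are invariant under simple reflections, and that [ad e] maps a root
    line onto the next one.  Descent on heights then yields the 24 positive roots
    of [F4], each of multiplicity one.

    An abelian ideal is stable under the Cartan subalgebra, hence is the direct
    sum of its weight components, and it meets the Cartan subalgebra trivially;
    so it is spanned by a set [A] of root vectors.  [A] is closed under adding
    simple roots and contains no two roots whose sum is the highest root, because
    brackets of such pairs are nonzero.  A finite enumeration leaves the 16 sets
    of the statement, and for these no two members add up to a root. *)

Set Implicit Arguments.
Unset Strict Implicit.
Unset Printing Implicit Defensive.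

Import Order.TTheory GRing.Theory Num.Theory.
Local Open Scope ring_scope.

(** * Eigenvectors *)

Section Eigenvectors.
Variables (K : fieldType) (L : vectType K).

(** Subtracting [lam i] times the sum from its image under [D] removes [v i] and multiplies every
    other term by a nonzero scalar. The result is a shorter sum in [U], so induction applies. *)
Lemma eigen_components (D : 'End(L)) (U : {vspace L}) (J : eqType) (s : seq J)
    (lam : J -> K) (v : J -> L) :
  (forall x, x \in U -> D x \in U) -> uniq [seq lam j | j <- s] ->
  (forall j, j \in s -> D (v j) = lam j *: v j) ->
  \sum_(j <- s) v j \in U -> forall j, j \in s -> v j \in U.
Proof.
move=> stabU; elim: s v => [//|i s IHs] v /= /andP[lam_i uniq_s] Dv.
rewrite big_cons => sumU.
have tailU j : j \in s -> v j \in U.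
  move=> sj; have neq_ji : lam j - lam i != 0.
    by rewrite subr_eq0; apply: contraNneq lam_i => <-; apply: map_f.
  suff: (lam j - lam i) *: v j \in U.
    by move/(memvZ (lam j - lam i)^-1); rewrite scalerA mulVf ?scale1r.
  apply: (IHs (fun j => (lam j - lam i) *: v j)) sj => // [k sk|].
    by rewrite linearZ /= Dv ?inE ?sk ?orbT // !scalerA mulrC.
  have -> : \sum_(j <- s) (lam j - lam i) *: v j
      = D (v i + \sum_(j <- s) v j) - lam i *: (v i + \sum_(j <- s) v j).
    rewrite linearD /= Dv ?mem_head // scalerDr opprD addrACA subrr add0r.
    rewrite linear_sum /= scaler_sumr -sumrB !big_seq.
    by apply: eq_bigr => k sk; rewrite Dv ?inE ?sk ?orbT // scalerBl.
  by rewrite memvB ?memvZ ?stabU.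
move=> j; rewrite inE => /predU1P[->|/tailU //].
rewrite -[v i](addrK (\sum_(j <- s) v j)) memvB // big_seq.
by apply: memv_suml.
Qed.

Lemma eigen_infinite (D : 'End(L)) (lam : nat -> K) (v : nat -> L) :
  injective lam -> (forall k, D (v k) = lam k *: v k) ->
  exists k, v k = 0.
Proof.
move=> lam_inj Dv; apply: contrapT => /forallNP v_neq0.
pose N := (\dim {:L}).+1.
have: free [tuple v i | i < N].
  apply/freeP => c; under eq_bigr do rewrite -tnth_nth tnth_mktuple.
  move=> sum0 i; have: c i *: v i \in (0%VS : {vspace L}).
    (* With [U] the zero subspace, splitting into components says that eigenvectors for distinct
       eigenvalues are linearly independent. *)
    apply: (@eigen_components D 0%VS _ (index_enum 'I_N)
      (fun i => lam i) (fun i => c i *: v i)).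
    - by move=> x; rewrite !memv0 => /eqP->; rewrite linear0.
    - rewrite map_inj_uniq ?index_enum_uniq //.
      by move=> j k /lam_inj /val_inj.
    - by move=> j _; rewrite linearZ /= Dv !scalerA mulrC.
    - by rewrite sum0 mem0v.
    - by rewrite mem_index_enum.
  by rewrite memv0 scaler_eq0 (negPf (introN eqP (v_neq0 i))) orbF => /eqP.
move/eqP; rewrite size_tuple => dimN.
by have := dimvS (subvf <<[tuple v i | i < N]>>%VS); rewrite dimN ltnn.
Qed.

(* An endomorphism diagonalizable on [L] has an eigenvector in every nonzero
   stable subspace: apply the factors of the minimal polynomial one by one. *)
Lemma diagonalizable_eigenvector (D : 'End(L)) (U : {vspace L}) (e : seq L) :
  basis_of fullv e -> (forall v, v \in e -> exists c : K, D v = c *: v) ->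
  (forall x, x \in U -> D x \in U) -> U != 0%VS ->
  exists c, exists2 u, u \in U /\ u != 0 & D u = c *: u.
Proof.
move=> base_e eig_e stabU U0.
pose E c : 'End(L) := D - c *: \1%VF.
have EE c x : E c x = D x - c *: x by rewrite /E !lfun_simp.
pose P cs x := foldl (fun x c => E c x) x cs.
have P_lin cs : linear (P cs).
  by elim: cs => [|c cs IH] k x y //=; rewrite linearP -/(P cs _) IH.
have P0 cs : P cs 0 = 0 by elim: cs => //= c cs; rewrite linear0.
have Peig cs c x : D x = c *: x -> c \in cs -> P cs x = 0.
  elim: cs x => [//|k cs IH] x Dx; rewrite inE /= EE => /predU1P[<-|cs_c].
    by rewrite Dx subrr P0.
  rewrite -/(P cs _); apply: IH => //.
  by rewrite Dx -scalerBl linearZ /= Dx !scalerA mulrC.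
have [cs Pcs] : exists cs, forall v, v \in e -> P cs v = 0.
  elim: {base_e} e eig_e => [|v e IH] eig_e; first by exists [::].
  have [|cs Pcs] := IH; first by move=> w ew; apply: eig_e; rewrite inE ew orbT.
  have [c Dv] := eig_e v (mem_head _ _).
  exists (c :: cs) => w; rewrite inE => /predU1P[->|ew].
    by apply: (Peig _ c) => //; apply: mem_head.
  have [d Dw] := eig_e w (mem_behead (s := v :: e) ew).
  rewrite /= EE Dw -scalerBl -/(P cs _).
  by have := P_lin cs (d - c) w 0; rewrite P0 !addr0 => ->; rewrite Pcs ?scaler0.
have Pall x : P cs x = 0.
  have: x \in <<e>>%VS by rewrite (span_basis base_e) memvf.
  move=> /(coord_span (X := in_tuple e)) ->.
  elim/big_rec: _ => [|i y _ Py]; first exact: P0.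
  by rewrite P_lin Py Pcs ?scaler0 ?addr0 // mem_nth.
have [x xU x0] : exists2 x, x \in U & x != 0.
  by exists (vpick U); rewrite ?memv_pick ?vpick0.
move: (Pall x); elim: cs x xU x0 {Pcs Pall} => [|c cs IH] x xU x0 /=.
  by move=> x_0; rewrite x_0 eqxx in x0.
have [|Ex0] := eqVneq (E c x) 0.
  by rewrite EE => /subr0_eq Dx _; exists c, x.
by apply: IH => //; rewrite EE memvB ?memvZ ?stabU.
Qed.

End Eigenvectors.

Lemma span_map_sum (K : fieldType) (L : vectType K) (J : eqType) (X : J -> L)
    (s : seq J) (x : L) : uniq s -> x \in <<map X s>>%VS ->
  exists2 y : J -> L, forall j, j \in s -> y j \in <[X j]>%VS
    & x = \sum_(j <- s) y j.
Proof.
elim: s x => [|i s IHs] x /=.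
  by rewrite span_nil memv0 => _ /eqP->; exists (fun=> 0); rewrite ?big_nil.
case/andP=> s'i uniq_s; rewrite span_cons => /memv_addP[u ui [v vs ->]].
have [y y_X ->] := IHs v uniq_s vs.
exists (fun j => if j == i then u else y j) => [j|].
  by rewrite inE; case: eqP => [-> //|_] /=; apply: y_X.
rewrite big_cons eqxx; congr (_ + _); apply: eq_big_seq => j sj.
by case: eqP => // ji; rewrite -ji sj in s'i.
Qed.

(** * Root spaces and sl2-triples *)

Section Bracket.
Variables (K : fieldType) (L : vectType K) (br : lieBracket L).

Lemma lieDr x y z : br x (y + z) = br x y + br x z.
Proof. by rewrite -!lie_adE linearD. Qed.

Lemma lieZr x c y : br x (c *: y) = c *: br x y.
Proof. by rewrite -!lie_adE linearZ. Qed.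

Lemma lie0r x : br x 0 = 0.
Proof. by rewrite -!lie_adE linear0. Qed.

Lemma lieDl x y z : br (x + y) z = br x z + br y z.
Proof. by have := lie_linearl br z 1 x y; rewrite !scale1r. Qed.

Lemma lieC x y : br x y = - br y x.
Proof.
apply/eqP; rewrite -addr_eq0; apply/eqP.
by have := lie_xx br (x + y); rewrite lieDr !lieDl !lie_xx add0r addr0 addrC.
Qed.

Lemma lieZl c x y : br (c *: x) y = c *: br x y.
Proof. by rewrite lieC lieZr -scalerN -lieC. Qed.

Lemma lie0l x : br 0 x = 0.
Proof. by rewrite lieC lie0r oppr0. Qed.

Lemma lieNl x y : br (- x) y = - br x y.
Proof. by rewrite -scaleN1r lieZl scaleN1r. Qed.

Lemma lieA x y z : br x (br y z) = br (br x y) z + br y (br x z).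
Proof.
have lieNr u v : br u (- v) = - br u v by rewrite -!lie_adE linearN.
rewrite (lieC (br x y)) (lieC x z) lieNr -opprD; apply/eqP.
by rewrite -addr_eq0 (addrC (br z _)) addrA lie_jacobi.
Qed.

Lemma lie_span_sub (s r : seq L) (W : {vspace L}) :
  (forall x y, x \in s -> y \in r -> br x y \in W) ->
  forall x y, x \in <<s>>%VS -> y \in <<r>>%VS -> br x y \in W.
Proof.
move=> srW x y xs yr.
have {yr} sW z : z \in s -> br z y \in W.
  move=> sz; rewrite (coord_span (X := in_tuple r) yr) lie_sumr.
  by apply: memv_suml => i _; rewrite memvZ // srW // mem_nth.
rewrite (coord_span (X := in_tuple s) xs) lie_suml.
by apply: memv_suml => i _; rewrite memvZ // sW // mem_nth.
Qed.

Section RootSpaces.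
Variable T : {vspace L}.
Implicit Types a b : 'Hom(subvs_of T, K^o).

Lemma root_space_br a b x y : x \in root_space br a ->
  y \in root_space br b -> br x y \in root_space br (a + b).
Proof.
move=> /root_spaceP xa /root_spaceP yb; apply/root_spaceP => h.
by rewrite lieA xa yb lieZl lieZr -scalerDl lfun_simp.
Qed.

Hypothesis cartanT : cartan_subalgebra br T.

(** This is where [T] being its own centralizer enters; it places brackets of opposite root vectors
    in [T]. *)
Lemma root_space0 : root_space br (0 : 'Hom(subvs_of T, K^o)) = T.
Proof.
have [abT cT _] := cartanT; apply/vspaceP => x; apply/idP/idP.
  move=> /root_spaceP x0; apply: cT => h hT.
  by rewrite -[h](vsprojK hT) x0 lfun_simp scale0r.
move=> xT; apply/root_spaceP => h.
by rewrite lfun_simp scale0r abT // subvsP.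
Qed.

Lemma root_space_cartan a t x : t \in T -> x \in root_space br a ->
  br t x = (a (vsproj T t) : K) *: x.
Proof. by move=> tT /root_spaceP <-; rewrite vsprojK. Qed.

End RootSpaces.
End Bracket.

(** The relations [h, e] = 2e and [h, f] = -2f are implied by the root space memberships and a(h) =
    2. *)
Definition sl2_triple (K : fieldType) (L : vectType K) (br : lieBracket L)
    (T : {vspace L}) (a : 'Hom(subvs_of T, K^o)) (e f : L) (h : subvs_of T) :=
  [/\ e \in root_space br a, f \in root_space br (- a), br e f = vsval h
    & a h = 2%:R].

(** Turns each statement about raising into one about lowering. *)
Lemma sl2_triple_sym (K : fieldType) (L : vectType K) (br : lieBracket L)
    (T : {vspace L}) (a : 'Hom(subvs_of T, K^o)) e f h :
  sl2_triple br a e f h -> sl2_triple br (- a) f e (- h).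
Proof.
case=> ea fa efh ah; split; rewrite ?opprK //.
  by rewrite lieC efh raddfN.
by rewrite opp_lfunE linearN opprK.
Qed.

(** * Weight spaces under a single sl2-triple *)

Section Sl2.
Variables (K : numFieldType) (L : vectType K) (br : lieBracket L).
Variables (T : {vspace L}) (a : 'Hom(subvs_of T, K^o)).
Variables (e f : L) (h : subvs_of T).
Hypothesis sl2 : sl2_triple br a e f h.
Implicit Types (b : 'Hom(subvs_of T, K^o)) (x y v w : L).

Lemma root_space_raise b v :
  v \in root_space br b -> br e v \in root_space br (b + a).
Proof. by rewrite addrC; apply: root_space_br; case: sl2. Qed.

Lemma root_space_lower b v :
  v \in root_space br b -> br f v \in root_space br (b - a).
Proof. by rewrite addrC; apply: root_space_br; case: sl2. Qed.

Lemma root_space_lowern b v k : v \in root_space br b ->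
  iter k (br f) v \in root_space br (b - a *+ k).
Proof.
move=> vb; elim: k => [|k IHk]; first by rewrite subr0.
by rewrite iterS mulrSr opprD addrA root_space_lower.
Qed.

Lemma sl2_commute b v : v \in root_space br b ->
  br e (br f v) = br f (br e v) + (b h : K) *: v.
Proof.
move=> /root_spaceP vb; case: sl2 => _ _ efh _.
by rewrite lieA efh vb addrC.
Qed.

(* If [v] were nonzero, so would be all [(ad e)^k v], which have distinct
   weights. *)
Lemma sl2_string b v (c : K) : v \in root_space br b ->
  br e (br f v) = c *: v ->
  (forall k : nat, k.+1%:R * ((b h : K) + k%:R) != c) -> v = 0.
Proof.
move=> vb efv nc; case: (sl2) => _ _ _ ah.
pose v_ k := iter k (br e) v.
have v_b k : v_ k \in root_space br (b + a *+ k).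
  elim: k => [|k IHk]; first by rewrite addr0.
  by rewrite /v_ iterS mulrSr addrA root_space_raise.
have v_h k : (b + a *+ k : 'Hom(_, _)) h = (b h : K) + (k.*2)%:R :> K.
  elim: k => [|k IHk]; first by rewrite !addr0.
  by rewrite mulrSr addrA lfun_simp IHk ah -addrA -natrD doubleS addn2.
(* Moving [f] past each [e] costs the weight b(h) + 2i, and these add up to (k + 1)(b(h) + k) for i
   from 0 to k. *)
have fv k : br f (v_ k.+1) = (c - k.+1%:R * ((b h : K) + k%:R)) *: v_ k.
  elim: k => [|k IHk].
    by apply/eqP; rewrite -(inj_eq (addIr ((b h : K) *: v))) -sl2_commute //
       efv -scalerDl mul1r addr0 subrK.
  apply: (addIr (((b + a *+ k.+1 : 'Hom(_, _)) h : K) *: v_ k.+1)).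
  rewrite -[v_ k.+2]/(br e (v_ k.+1)) -(sl2_commute (v_b k.+1)) IHk lieZr.
  rewrite -[br e (v_ k)]/(v_ k.+1) -scalerDl v_h.
  congr (_ *: _); rewrite doubleS -muln2; ring.
have [|k|k v_k0] := @eigen_infinite _ _ (lie_ad br (vsval h))
    (fun k => (b h : K) + (k.*2)%:R) v_.
- by move=> j k /addrI /eqP; rewrite eqr_nat => /eqP /double_inj.
- by rewrite lie_adE; move/root_spaceP: (v_b k) => ->; rewrite v_h.
(* By [fv] and the assumption on [c], applying [f] carries the vanishing of one vector of the string
   down to the previous one, and finally to [v]. *)
elim: k v_k0 => [//|k IHk v_k0]; apply: IHk.
move: (fv k); rewrite v_k0 lie0r => /esym/eqP.
by rewrite scaler_eq0 subr_eq0 eq_sym (negPf (nc k)) => /eqP.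
Qed.

Lemma sl2_ef_inj b v : v \in root_space br b -> 0 < (b h : K) ->
  br e (br f v) = 0 -> v = 0.
Proof.
move=> vb b_gt0 efv; apply: (@sl2_string b v 0 vb); first by rewrite scale0r.
by move=> k; rewrite mulf_neq0 ?pnatr_eq0 // gt_eqF // ltr_wpDr // ler0n.
Qed.

Lemma sl2_dim1 : cartan_subalgebra br T -> root_space br a = <[e]>%VS.
Proof.
move=> cartanT; case: (sl2) => ea fa efh ah; apply/eqP.
rewrite eqEsubv -!memvE ea andbT; apply/subvP => x xa.
have fxT: br f x \in T.
  by rewrite -(root_space0 cartanT) -(subrr a) root_space_lower.
(* Since [e, [f, x]] = -a([f, x]) e and [e, [f, e]] = 2e, this [c] makes ef kill x + c e, and
   [sl2_ef_inj] applies. *)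
pose c : K := (a (vsproj T (br f x)) : K) / 2%:R.
suff /eqP: x + c *: e = 0.
  by rewrite addr_eq0 => /eqP->; rewrite memvN memvZ ?memv_line.
have xa' : x + c *: e \in root_space br a by rewrite memvD ?memvZ.
apply: (sl2_ef_inj xa'); first by rewrite ah ltr0n.
have fe : br f e = - vsval h by rewrite lieC efh.
rewrite lieDr lieZr fe lieDr (lieC br e (br f x)) (root_space_cartan fxT ea).
rewrite lieZr (lieC br e (- _)) lieNl opprK (_ : br (vsval h) e = 2%:R *: e); last first.
  by move/root_spaceP: ea => ->; rewrite ah.
by rewrite scalerA divfK ?pnatr_eq0 // addNr.
Qed.

(** By [sl2_ef_inj] it suffices that ef kills the space. For 2a, [f] lands in the line of [e], which
    [e] kills; for higher multiples, [f] lands in a space already known to vanish. *)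
Lemma sl2_multiple k : cartan_subalgebra br T ->
  root_space br (a *+ k.+2) = 0%VS.
Proof.
move=> cartanT; case: (sl2) => ea fa efh ah.
have ah_gt0 j : 0 < ((a *+ j.+1 : 'Hom(_, _)) h : K).
  elim: j => [|j IHj]; first by rewrite ah ltr0n.
  by rewrite mulrS lfun_simp addr_gt0 // ah ltr0n.
apply/eqP; rewrite -subv0; apply/subvP => v va.
suff -> : v = 0 by exact: mem0v.
have fv: br f v \in root_space br (a *+ k.+1).
  by have := root_space_lower va; rewrite mulrSr addrK.
apply: (sl2_ef_inj va (ah_gt0 _)).
elim: k v va fv => [|k IHk] v va.
  by rewrite mulr1n (sl2_dim1 cartanT) => /vlineP[c ->]; rewrite lieZr lie_xx scaler0.
move=> fv; suff -> : br f v = 0 by rewrite lie0r.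
have ffv: br f (br f v) \in root_space br (a *+ k.+1).
  by have := root_space_lower fv; rewrite mulrSr addrK.
by apply: (sl2_ef_inj fv (ah_gt0 _)); apply: IHk.
Qed.

Lemma sl2_commuten b v k : v \in root_space br b ->
  br e (iter k.+1 (br f) v) = iter k.+1 (br f) (br e v)
    + (k.+1%:R * ((b h : K) - k%:R)) *: iter k (br f) v.
Proof.
move=> vb; case: (sl2) => _ _ _ ah.
elim: k => [|k IHk]; first by rewrite /= mul1r subr0 (sl2_commute vb).
rewrite iterS (sl2_commute (root_space_lowern k.+1 vb)) IHk.
rewrite lieDr lieZr -!iterS -addrA -scalerDl; congr (_ + _ *: _).
have -> : (b - a *+ k.+1 : 'Hom(_, _)) h = (b h : K) - (k.+1.*2)%:R :> K.
  elim: k {IHk} => [|k IHk]; first by rewrite !lfun_simp ah.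
  by rewrite mulrSr opprD addrA lfun_simp IHk lfun_simp ah -addrA -opprD -natrD
     doubleS addn2.
rewrite -muln2; ring.
Qed.

(** If the (j+1)-st power of [f] kills [v], commuting [e] past it shows that the j-th power kills fe
    v + c v with c = (j + 1)(n - j) > 0. By induction fe v = -c v, so ef v = (n - c) v, and n - c is
    below all the values (k + 1)(n + k) excluded in [sl2_string]. *)
Lemma sl2_lowern_inj b v (n j : nat) : v \in root_space br b ->
  (b h : K) = n%:R -> (j <= n)%N -> iter j (br f) v = 0 -> v = 0.
Proof.
move=> vb bh; elim: j v vb => [//|j IHj] v vb le_jn fv0.
pose c : K := j.+1%:R * ((b h : K) - j%:R).
have wb: br f (br e v) + c *: v \in root_space br b.
  rewrite memvD ?memvZ //.
  by have := root_space_lower (root_space_raise vb); rewrite addrK.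
have w0 : br f (br e v) + c *: v = 0.
  apply: (IHj _ wb (ltnW le_jn)).
  have := sl2_commuten j vb; rewrite fv0 lie0r iterSr => /esym.
  have iter_lin g z d : iter j (br f) (g + d *: z)
      = iter j (br f) g + d *: iter j (br f) z.
    by elim: j {IHj le_jn fv0 c wb} => //= j ->; rewrite lieDr lieZr.
  by rewrite iter_lin.
apply: (@sl2_string b v ((b h : K) - c) vb).
  rewrite (sl2_commute vb) -[br f (br e v)](addrK (c *: v)) w0 sub0r.
  by rewrite addrC -scalerBl.
move=> k; rewrite gt_eqF // /c bh -natrB 1?ltnW // -!natrD -!natrM.
rewrite ltrBlDr -natrD ltr_nat; nia.
Qed.

Lemma sl2_dim_le b (n : nat) : (b h : K) = n%:R ->
  (\dim (root_space br b) <= \dim (root_space br (b - a *+ n)%R))%N.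
Proof.
move=> bh.
pose D := iter n (fun g : 'End(L) => lie_ad br f \o g)%VF \1%VF.
have DE x : D x = iter n (br f) x.
  rewrite /D; elim: (n) => [|k IHk]; first by rewrite lfun_simp.
  by rewrite !iterS comp_lfunE lie_adE IHk.
have <- : \dim (D @: root_space br b) = \dim (root_space br b).
  apply: limg_dim_eq; apply/eqP; rewrite -subv0; apply/subvP => x.
  rewrite memv_cap memv_ker DE memv0 => /andP[xb /eqP Dx0].
  by apply/eqP; apply: (sl2_lowern_inj xb bh (leqnn n)).
apply: dimvS; apply/subvP => _ /memv_imgP[x xb ->].
by rewrite DE root_space_lowern.
Qed.

End Sl2.

(** * Reflections, coroots and faithfulness of the roots *)

Section Coroots.
Variables (K : numFieldType) (L : vectType K) (br : lieBracket L).
Variables (T : {vspace L}).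
Implicit Types a b : 'Hom(subvs_of T, K^o).

Lemma hom_Mn a k t : (a *+ k) t = (a t : K) *+ k.
Proof.
by elim: k => [|k IHk]; rewrite ?lfun_simp // !mulrSr lfun_simp IHk.
Qed.

Lemma hom_subMn a b k t : (b - a *+ k) t = (b t : K) - (a t : K) *+ k.
Proof. by rewrite lfun_simp opp_lfunE hom_Mn. Qed.

(** The weight b - n a is the reflection of [b]; the opposite triple gives the reverse
    inequality. *)
Lemma sl2_dim_eq a e f h b (n : nat) : sl2_triple br a e f h ->
  (b h : K) = n%:R ->
  \dim (root_space br b) = \dim (root_space br (b - a *+ n)).
Proof.
move=> sl2 bh; apply/eqP; rewrite eqn_leq (sl2_dim_le sl2 bh) /=.
have [_ _ _ ah] := sl2; have bh' : ((b - a *+ n) (- h) : K) = n%:R.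
  rewrite linearN /= hom_subMn ah bh -mulrnA; ring.
have := sl2_dim_le (sl2_triple_sym sl2) bh'.
by rewrite mulNrn opprK subrK.
Qed.

(** If p < 0, then fe is injective on the weight space of [b]. If p >= 0, then ef is injective on
    that of b + a, so [e] is nonzero on some f w, which is a multiple of [x] because [x] spans its
    weight space. *)
Lemma sl2_raise_neq0 a e f h b x (p : int) : sl2_triple br a e f h ->
  (b h : K) = p%:~R -> \dim (root_space br b) = 1%N ->
  root_space br (b + a) != 0%VS -> x \in root_space br b -> x != 0 ->
  br e x != 0.
Proof.
move=> sl2 bh dim1 ba0 xb x0; have [_ _ _ ah] := sl2.
have [p_lt0|p_ge0] := ltP p 0.
  apply: contraNneq x0 => ex0; apply/eqP.
  apply: (sl2_ef_inj (sl2_triple_sym sl2) xb); last by rewrite ex0 lie0r.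
  by rewrite linearN /= bh -mulrNz ltr0z oppr_gt0.
pose w := vpick (root_space br (b + a)).
have w_ba : w \in root_space br (b + a) by exact: memv_pick.
have fw_b : br f w \in root_space br b.
  by have := root_space_lower sl2 w_ba; rewrite addrK.
have efw : br e (br f w) != 0.
  apply: contraNneq ba0 => /(sl2_ef_inj sl2 w_ba) => w0.
  rewrite -vpick0; apply/eqP/w0.
  by rewrite lfun_simp bh ah ltr_wpDl ?ler0z ?ltr0n.
have bx : root_space br b = <[x]>%VS.
  by apply/esym/eqP; rewrite eqEdim -memvE xb dim1 dim_vline x0.
move: fw_b efw; rewrite bx => /vlineP[c ->].
by rewrite lieZr scaler_eq0 negb_or => /andP[].
Qed.

(** A coroot is only given as a sum of brackets. Some single bracket is not killed by [a], as
    otherwise a(h) = 0; rescaled, it yields a triple. Both root spaces are then lines, so [h] is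
    proportional to the new coroot, and a(h) = 2 forces equality. *)
Lemma is_coroot_sl2 a h : cartan_subalgebra br T -> is_coroot br a h ->
  exists e f, sl2_triple br a e f h.
Proof.
move=> cartanT [ha ah].
have brT x y : x \in root_space br a -> y \in root_space br (- a) -> br x y \in T.
  by move=> xa ya; rewrite -(root_space0 cartanT) -(subrr a) root_space_br.
have [x [y [xa ya axy]]] : exists x y, [/\ x \in root_space br a,
    y \in root_space br (- a) & a (vsproj T (br x y)) != 0].
  apply: contrapT => no_xy.
  have: vsval h \in (linfun vsval @: lker a)%VS.
    move: ha; rewrite !memvE => /subv_trans; apply; apply/lie_prodP => x y xa ya.
    rewrite -[br x y](vsprojK (brT x y xa ya)) -[vsval _]lfunE memv_img //.
    rewrite memv_ker; apply: contrapT => axy; apply: no_xy.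
    by exists x, y; split => //; apply/negP.
  case/memv_imgP => t; rewrite memv_ker => /eqP at0; rewrite lfunE => /val_inj ht.
  by move: ah; rewrite ht at0 => /esym/eqP; rewrite pnatr_eq0.
pose c : K := 2%:R / (a (vsproj T (br x y)) : K).
have sl2 : sl2_triple br a x (c *: y) (vsproj T (br x (c *: y))).
  have cya : c *: y \in root_space br (- a) by rewrite memvZ.
  split; rewrite ?vsprojK ?brT // lieZr !linearZ; exact: (divfK axy).
exists x, (c *: y).
suff -> : h = vsproj T (br x (c *: y)) by [].
have [_ _ brxy a2] := sl2.
have ex := sl2_dim1 sl2 cartanT.
have ey := sl2_dim1 (sl2_triple_sym sl2) cartanT.
have: vsval h \in <[br x (c *: y)]>%VS.
  move: ha; rewrite !memvE => /subv_trans; apply; apply/lie_prodP => u v.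
  rewrite ex ey => /vlineP[k ->] /vlineP[l ->].
  by rewrite lieZl lieZr !memvZ // memv_line.
case/vlineP => k; rewrite brxy -linearZ => /val_inj hk.
suff k1 : k = 1 by rewrite vsvalK hk k1 scale1r.
apply: (@mulIf _ (2%:R : K)); first by rewrite pnatr_eq0.
by rewrite mul1r -[RHS]ah hk linearZ -a2.
Qed.

(* A nonzero weight of [t] on [L] would occur on a common eigenvector of [T],
   that is on a root vector. *)
Lemma cartan_faithful t : lie_simple br -> cartan_subalgebra br T ->
  t \in T ->
  (forall a, is_root br a -> a (vsproj T t) = 0) -> t = 0.
Proof.
move=> [nabL simpleL] [abT cT diagT] tT roots0.
(* A central [t] spans an ideal. It cannot be all of the simple algebra, which is not abelian, so it
   is zero. *)
suff br_t x : br t x = 0.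
  have [|t0|tL] := simpleL <[t]>%VS.
  - split=> [|x _ _ /vlineP[k ->]]; first exact: subvf.
    by rewrite lieC lieZl br_t scaler0 oppr0 mem0v.
  - by apply/eqP; rewrite -memv0 -t0 memv_line.
  case: nabL => x y; rewrite -tL => /vlineP[k ->] _.
  by rewrite lieZl br_t scaler0.
have [e base_e eig_e] := diagT t tT.
suff br_te v : v \in e -> br t v = 0.
  have: x \in <<e>>%VS by rewrite (span_basis base_e) memvf.
  move/(coord_span (X := in_tuple e)) ->; rewrite lie_sumr big1 // => i _.
  by rewrite br_te ?scaler0 ?mem_nth.
move=> {x} ev; have [c tv] := eig_e v ev; have [c0|c0] := eqVneq c 0.
  by rewrite tv c0 scale0r.
have [->|v0] := eqVneq v 0; first exact: lie0r.
pose E := lker (lie_ad br t - c *: \1%VF).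
have EE y : (y \in E) = (br t y == c *: y).
  by rewrite memv_ker !lfun_simp lie_adE subr_eq0.
have [w [Ew w0 eig_w]] : exists w, [/\ w \in E, w != 0 &
    forall h, h \in T -> exists k : K, br h w = k *: w].
  (* Starting from the eigenspace [E] of [t], intersect successively with an eigenspace of each
     basis vector of [T]. The pieces stay nonzero and, since [T] is abelian, stable under [T]. *)
  have: exists2 U : {vspace L}, (U <= E)%VS /\ U != 0%VS &
      (forall h x, h \in T -> x \in U -> br h x \in U) /\
      forall h, h \in (vbasis T : seq L) -> exists k : K,
        forall x, x \in U -> br h x = k *: x.
    have: {subset (vbasis T : seq L) <= T} by move=> x; apply: vbasis_mem.
    elim: (vbasis T : seq L) => [|h s IHs] sT.
      exists E; split => //.
        by apply: contraNneq v0 => E0; rewrite -memv0 -E0 EE tv.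
      move=> h x hT; rewrite !EE => /eqP tx.
      by rewrite lieA tx (abT t h) // lie0l add0r lieZr.
    have [U [UE U0] [stabU eigU]] :=
      IHs (fun x sx => sT x (mem_behead (s := h :: s) sx)).
    have hT : h \in T by apply: sT; apply: mem_head.
    have [b base_b eig_b] := diagT h hT.
    have [| |k [u [uU u0]] hu] :=
      diagonalizable_eigenvector (D := lie_ad br h) base_b _ _ U0.
    - by move=> x /eig_b[k hx]; exists k; rewrite lie_adE.
    - by move=> x; rewrite lie_adE; apply: stabU.
    exists (U :&: lker (lie_ad br h - k *: \1%VF))%VS; split.
    - exact: subv_trans (capvSl _ _) UE.
    - apply: contraNneq u0 => U'0; rewrite -memv0 -U'0 memv_cap uU.
      by rewrite memv_ker !lfun_simp hu subrr eqxx.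
    - move=> h' x h'T; rewrite !memv_cap !memv_ker !lfun_simp !lie_adE !subr_eq0.
      move=> /andP[xU /eqP hx]; rewrite stabU //=.
      by rewrite lieA hx (abT h h') // lie0l add0r lieZr.
    - move=> h'; rewrite inE => /predU1P[->|/eigU[k' eig']].
        exists k => x; rewrite memv_cap memv_ker !lfun_simp lie_adE subr_eq0.
        by case/andP => _ /eqP.
      by exists k' => x; rewrite memv_cap => /andP[/eig'].
  case=> U [UE U0] [_ eigU]; exists (vpick U); split.
  - by apply: (subvP UE); apply: memv_pick.
  - by rewrite vpick0.
  move=> h hT.
  have : br h (vpick U) \in <[vpick U]>%VS.
    apply: (@lie_span_sub _ _ br (vbasis T) [:: vpick U]).
    - move=> x y xT; rewrite inE => /eqP->; have [k ->] := eigU x xT.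
        by rewrite memvZ ?memv_line.
      exact: memv_pick.
    - by rewrite (span_basis (vbasisP T)).
    - by rewrite span_seq1 memv_line.
  by case/vlineP => k; exists k.
pose coef : L -> K^o := coord [tuple w] 0.
have coefw k : coef (k *: w) = k.
  by rewrite /coef linearZ /= (coord_free 0 0) ?mulr1 // seq1_free.
(* The weight of [w], written through ad w to make it linear in the element of [T]; this order of
   the bracket accounts for the sign. *)
pose a : 'Hom(subvs_of T, K^o) := - linfun (coef \o lie_ad br w \o vsval).
have aE h : br (vsval h) w = (a h : K) *: w.
  have [k hw] := eig_w _ (subvsP h); rewrite hw; congr (_ *: _).
  rewrite opp_lfunE lfunE /= lie_adE lieC hw -scaleNr.
  by rewrite -[coord _ _ _]/(coef (- k *: w)) coefw opprK.
have wa : w \in root_space br a by apply/root_spaceP.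
have tw : (a (vsproj T t) : K) *: w = c *: w.
  by rewrite -aE vsprojK //; move: Ew; rewrite EE => /eqP.
have ac : a (vsproj T t) = c.
  by apply/eqP; rewrite -subr_eq0; move/eqP: tw; rewrite -subr_eq0 -scalerBl
     scaler_eq0 (negPf w0) orbF.
have := c0; rewrite -ac roots0 ?eqxx //; split.
  by apply: contraNneq c0 => a0; rewrite -ac a0 lfun_simp.
by apply: contraNneq w0 => a0; rewrite -memv0 -a0.
Qed.

End Coroots.

(** * Combinatorics of the positive roots of F4 *)

(** Coordinates in plain natural numbers let [vm_compute] decide the finite checks on roots. *)
Definition rootc := (nat * nat * nat * nat)%type.

Definition rc_coord (m : rootc) (i : nat) : nat :=
  let: (a, b, c, d) := m in nth 0%N [:: a; b; c; d] i.

Definition rc_tuple (m : rootc) : 4.-tuple nat :=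
  let: (a, b, c, d) := m in [tuple a; b; c; d].

Definition rc_add (m k : rootc) : rootc :=
  let: (a, b, c, d) := m in let: (a', b', c', d') := k in
  (a + a', b + b', c + c', d + d')%N.

Definition rc_sub (m k : rootc) : rootc :=
  let: (a, b, c, d) := m in let: (a', b', c', d') := k in
  (a - a', b - b', c - c', d - d')%N.

Definition rc_single (j n : nat) : rootc :=
  match j with
  | 0 => (n, 0, 0, 0)%N
  | 1 => (0, n, 0, 0)%N
  | 2 => (0, 0, n, 0)%N
  | _ => (0, 0, 0, n)%N
  end.

Definition rc_height (m : rootc) : nat := let: (a, b, c, d) := m in a + b + c + d.

Definition rc0 : rootc := (0, 0, 0, 0)%N.

(* [F4_pairing m j] is the Cartan integer of [m] with the simple root [j], i.e.
   the entry [j] of the product of [m] with the Cartan matrix. *)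
Definition F4_pairing (m : rootc) (j : nat) : int :=
  let: (a, b, c, d) := m in
  match j with
  | 0 => a%:Z * 2 - b%:Z
  | 1 => b%:Z * 2 - a%:Z - c%:Z
  | 2 => c%:Z * 2 - b%:Z * 2 - d%:Z
  | _ => d%:Z * 2 - c%:Z
  end.

(* Sorted lexicographically, so that every root precedes its sums with simple
   roots, and sublists list the roots in the order of the statement. *)
Definition F4_roots : seq rootc :=
  [:: (0, 0, 0, 1); (0, 0, 1, 0); (0, 0, 1, 1); (0, 1, 0, 0); (0, 1, 1, 0);
      (0, 1, 1, 1); (0, 1, 2, 0); (0, 1, 2, 1); (0, 1, 2, 2); (1, 0, 0, 0);
      (1, 1, 0, 0); (1, 1, 1, 0); (1, 1, 1, 1); (1, 1, 2, 0); (1, 1, 2, 1);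
      (1, 1, 2, 2); (1, 2, 2, 0); (1, 2, 2, 1); (1, 2, 2, 2); (1, 2, 3, 1);
      (1, 2, 3, 2); (1, 2, 4, 2); (1, 3, 4, 2); (2, 3, 4, 2)]%N.

Definition F4_highest : rootc := (2, 3, 4, 2)%N.

(** The empty set, for the zero ideal, is left out and prepended where needed. *)
Definition F4_abelian_ideals : seq (seq rootc) :=
  [:: [:: (2, 3, 4, 2)];
    [:: (1, 3, 4, 2); (2, 3, 4, 2)];
    [:: (1, 2, 4, 2); (1, 3, 4, 2); (2, 3, 4, 2)];
    [:: (1, 2, 3, 2); (1, 2, 4, 2); (1, 3, 4, 2); (2, 3, 4, 2)];
    [:: (1, 2, 2, 2); (1, 2, 3, 2); (1, 2, 4, 2); (1, 3, 4, 2); (2, 3, 4, 2)];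
    [:: (1, 2, 3, 1); (1, 2, 3, 2); (1, 2, 4, 2); (1, 3, 4, 2); (2, 3, 4, 2)];
    [:: (1, 1, 2, 2); (1, 2, 2, 2); (1, 2, 3, 2); (1, 2, 4, 2); (1, 3, 4, 2);
        (2, 3, 4, 2)];
    [:: (1, 2, 2, 2); (1, 2, 3, 1); (1, 2, 3, 2); (1, 2, 4, 2); (1, 3, 4, 2);
        (2, 3, 4, 2)];
    [:: (0, 1, 2, 2); (1, 1, 2, 2); (1, 2, 2, 2); (1, 2, 3, 2); (1, 2, 4, 2);
        (1, 3, 4, 2); (2, 3, 4, 2)];
    [:: (1, 1, 2, 2); (1, 2, 2, 2); (1, 2, 3, 1); (1, 2, 3, 2); (1, 2, 4, 2);
        (1, 3, 4, 2); (2, 3, 4, 2)];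
    [:: (1, 2, 2, 1); (1, 2, 2, 2); (1, 2, 3, 1); (1, 2, 3, 2); (1, 2, 4, 2);
        (1, 3, 4, 2); (2, 3, 4, 2)];
    [:: (1, 2, 2, 0); (1, 2, 2, 1); (1, 2, 2, 2); (1, 2, 3, 1); (1, 2, 3, 2);
        (1, 2, 4, 2); (1, 3, 4, 2); (2, 3, 4, 2)];
    [:: (0, 1, 2, 2); (1, 1, 2, 2); (1, 2, 2, 2); (1, 2, 3, 1); (1, 2, 3, 2);
        (1, 2, 4, 2); (1, 3, 4, 2); (2, 3, 4, 2)];
    [:: (1, 1, 2, 2); (1, 2, 2, 1); (1, 2, 2, 2); (1, 2, 3, 1); (1, 2, 3, 2);
        (1, 2, 4, 2); (1, 3, 4, 2); (2, 3, 4, 2)];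
    [:: (0, 1, 2, 2); (1, 1, 2, 2); (1, 2, 2, 1); (1, 2, 2, 2); (1, 2, 3, 1);
        (1, 2, 3, 2); (1, 2, 4, 2); (1, 3, 4, 2); (2, 3, 4, 2)]]%N.

(** The inverse Cartan matrix has positive entries, so pairings that are all at most 0 would force
    nonnegative coordinates to vanish. This starts the descent on heights. *)
Lemma F4_pairing_gt0 (m : rootc) : m != rc0 -> exists2 j, (j < 4)%N & 0 < F4_pairing m j.
Proof.
case: m => [[[a b] c] d] m0; apply: contrapT => no_j.
have p_le0 j : (j < 4)%N -> F4_pairing (a, b, c, d) j <= 0.
  by move=> j4; rewrite leNgt; apply/negP => p_gt0; apply: no_j; exists j.
move: (p_le0 0%N isT) (p_le0 1%N isT) (p_le0 2%N isT) (p_le0 3%N isT) => /= p0 p1 p2 p3.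
by move/eqP: m0; apply; congr (_, _, _, _); lia.
Qed.

(** Both directions are finite checks on [F4_roots]. Since [m] is arbitrary, the direct implication
    reflects the listed root back up to [m]. *)
Lemma F4_reflect m j (n := `|F4_pairing m j|%N) : (j < 4)%N ->
  0 < F4_pairing m j -> (n <= rc_coord m j)%N ->
  (rc_sub m (rc_single j n) \in F4_roots) = (m \in F4_roots).
Proof.
move=> j4 p_gt0 le_n; apply/idP/idP => [m'_root|m_root].
  have down : all (fun k => all (fun j =>
      (F4_pairing k j < 0) ==>
      (rc_add k (rc_single j `|F4_pairing k j|%N) \in F4_roots)) (iota 0 4)) F4_roots.
    by vm_compute.
  have [m'E np] : rc_add (rc_sub m (rc_single j n)) (rc_single j n) = m /\
      F4_pairing (rc_sub m (rc_single j n)) j = - n%:Z.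
    rewrite /n; move: j4 p_gt0 le_n; rewrite /n; case: (m) => [[[a b] c] d].
    by case: j {n m'_root} => [|[|[|[|//]]]] _ /= p_gt0 le_n;
      (split; [congr (_, _, _, _); lia | lia]).
  have := allP (allP down _ m'_root) j; rewrite mem_iota j4 => /(_ isT).
  rewrite np oppr_lt0 abszN absz_nat m'E => /implyP; apply.
  by rewrite /n; lia.
have up : all (fun k => all (fun j =>
    (0 < F4_pairing k j) && (`|F4_pairing k j| <= rc_coord k j)%N ==>
    (rc_sub k (rc_single j `|F4_pairing k j|%N) \in F4_roots)) (iota 0 4)) F4_roots.
  by vm_compute.
have := allP (allP up _ m_root) j; rewrite mem_iota j4 => /(_ isT) /implyP; apply.
by rewrite p_gt0.
Qed.

(** The assumption says that the reflected [j]-th coordinate is negative: a simple reflection makes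
    only its own simple root negative. *)
Lemma F4_reflect_neg m j : (j < 4)%N -> m \in F4_roots ->
  (rc_coord m j)%:Z < F4_pairing m j -> m = rc_single j 1.
Proof.
have neg : all (fun k => all (fun j =>
    ((rc_coord k j)%:Z < F4_pairing k j) ==> (k == rc_single j 1)) (iota 0 4)) F4_roots.
  by vm_compute.
move=> j4 m_root lt_p; have := allP (allP neg _ m_root) j.
by rewrite mem_iota j4 lt_p => /(_ isT) /eqP.
Qed.

Definition F4_extends (m : rootc) (s A : seq rootc) : bool :=
  all (fun j => (rc_add m (rc_single j 1) \in s) ==>
                (rc_add m (rc_single j 1) \in A)) (iota 0 4)
  && ~~ has (fun k => rc_add m k == F4_highest) A.

(* The sets of roots in [s] closed under adding simple roots and without two
   roots adding up to the highest root, built by scanning [s] from the right. *)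
Fixpoint F4_candidates (s : seq rootc) : seq (seq rootc) :=
  if s is m :: s' then
    let c := F4_candidates s' in
    c ++ [seq m :: A | A <- c & F4_extends m s' A]
  else [:: [::]].

Lemma F4_candidatesP (P : pred rootc) :
  (forall m j, (j < 4)%N -> m \in F4_roots ->
    rc_add m (rc_single j 1) \in F4_roots -> P m -> P (rc_add m (rc_single j 1))) ->
  (forall m k, m \in F4_roots -> k \in F4_roots -> rc_add m k = F4_highest ->
    P m -> ~~ P k) ->
  [seq m <- F4_roots | P m] \in [::] :: F4_abelian_ideals.
Proof.
move=> P_add P_high.
suff cand s : {subset s <= F4_roots} -> [seq m <- s | P m] \in F4_candidates s.
  (* The enumeration itself: no candidate falls outside the 16 sets. *)
  have: all [in [::] :: F4_abelian_ideals] (F4_candidates F4_roots) by vm_compute.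
  by move/allP; apply; apply: cand.
elim: s => [|m s IHs] sub_s //=.
have {}IHs := IHs (fun k sk => sub_s k (mem_behead (s := m :: s) sk)).
have m_root := sub_s m (mem_head _ _).
rewrite mem_cat; case: ifP => [Pm|_]; last by rewrite IHs.
apply/orP; right; apply: map_f; rewrite mem_filter IHs andbT; apply/andP; split.
  apply/allP => j; rewrite mem_iota => /= j4; apply/implyP => sj.
  by rewrite mem_filter sj andbT P_add // sub_s // inE sj orbT.
apply/hasPn => k; rewrite mem_filter => /andP[Pk sk].
have k_root : k \in F4_roots by rewrite sub_s // inE sk orbT.
by apply: contraL Pk => /eqP /P_high; apply.
Qed.

Lemma F4_abelian_idealsP A : A \in [::] :: F4_abelian_ideals ->
  [/\ uniq A, {subset A <= F4_roots},
      forall m k, m \in F4_roots -> k \in A -> rc_add m k \in F4_roots ->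
        rc_add m k \in A &
      forall m k, m \in A -> k \in A -> rc_add m k \notin F4_roots].
Proof.
move=> A_ideal.
have: all (fun A => [&& uniq A, all [in F4_roots] A,
    all (fun m => all (fun k => (rc_add m k \in F4_roots) ==> (rc_add m k \in A)) A)
      F4_roots &
    all (fun m => all (fun k => rc_add m k \notin F4_roots) A) A])
    ([::] :: F4_abelian_ideals) by vm_compute.
move=> /allP /(_ A A_ideal) /and4P[uniq_A /allP sub_A /allP closed_A /allP abel_A].
split=> // m k mA kA; last exact: allP (abel_A m mA) k kA.
by apply/implyP; apply: allP (closed_A m mA) k kA.
Qed.

Lemma F4_abelian_ideals_eq A A' : A \in [::] :: F4_abelian_ideals ->
  A' \in [::] :: F4_abelian_ideals -> A =i A' -> A = A'.
Proof.
move=> A_ideal A'_ideal eqA.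
have: all (fun A => all (fun A' =>
    all [in A'] A && all [in A] A' ==> (A == A')) ([::] :: F4_abelian_ideals))
    ([::] :: F4_abelian_ideals) by vm_compute.
move=> /allP /(_ A A_ideal) /allP /(_ A' A'_ideal) /implyP.
move=> /(_ _)/eqP; apply.
by apply/andP; split; apply/allP => m /=; rewrite eqA.
Qed.

(* Roots not orthogonal to the highest root, except that root itself, are those
   with first coordinate 1; they are reached from the first simple root by adding
   simple roots other than it. *)
Lemma F4_highest_pair m k : m \in F4_roots -> k \in F4_roots ->
  rc_add m k = F4_highest -> m != rc_single 0 1 ->
  exists m' j, [/\ (0 < j < 4)%N, m' \in F4_roots, m = rc_add m' (rc_single j 1),
    rc_add k (rc_single j 1) \in F4_roots & (rc_add m' k \notin F4_roots)].
Proof.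
move=> m_root k_root mk m1.
have: all (fun m => all (fun k => (rc_add m k == F4_highest) && (m != rc_single 0 1) ==>
    has (fun j => let m' := rc_sub m (rc_single j 1) in
    [&& m' \in F4_roots, m == rc_add m' (rc_single j 1),
      rc_add k (rc_single j 1) \in F4_roots & rc_add m' k \notin F4_roots])
    (iota 1 3)) F4_roots) F4_roots by vm_compute.
move=> /allP /(_ m m_root) /allP /(_ k k_root); rewrite mk m1 eqxx => /hasP[j].
rewrite mem_iota => j4 /and4P[m'_root /eqP mE kj m'k].
by exists (rc_sub m (rc_single j 1)), j; split.
Qed.

(** * Root spaces of type F4 *)

Definition rc_root (V : nmodType) (al : 4.-tuple V) (m : rootc) : V :=
  natcomb al (rc_tuple m).

Lemma tnth_rc_tuple m i : tnth (rc_tuple m) i = rc_coord m i.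
Proof. by case: m => [[[a b] c] d]; rewrite (tnth_nth 0%N). Qed.

Lemma rc_coord_inj m k :
  (forall i : 'I_4, rc_coord m i = rc_coord k i) -> m = k.
Proof.
case: m k => [[[a b] c] d] [[[a' b'] c'] d'] eq_mk.
have /= <- := eq_mk (@Ordinal 4 0 isT); have /= <- := eq_mk (@Ordinal 4 1 isT).
by have /= <- := eq_mk (@Ordinal 4 2 isT); have /= <- := eq_mk (@Ordinal 4 3 isT).
Qed.

Lemma rc_coord_add m k i : rc_coord (rc_add m k) i = (rc_coord m i + rc_coord k i)%N.
Proof.
by case: m k => [[[a b] c] d] [[[a' b'] c'] d']; case: i => [|[|[|[|i]]]] //=;
   rewrite !nth_nil.
Qed.

Lemma rc_coord_single (i j : 'I_4) n : rc_coord (rc_single j n) i = ((i == j) * n)%N.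
Proof.
by case: j i => [[|[|[|[|//]]]] j4] [[|[|[|[|//]]]] i4]; rewrite -val_eqE /= ?mul1n.
Qed.

Lemma rc_add_sub m (j : 'I_4) n : (n <= rc_coord m j)%N ->
  rc_add (rc_sub m (rc_single j n)) (rc_single j n) = m.
Proof.
case: m j => [[[a b] c] d] [[|[|[|[|//]]]] j4] /= le_n; congr (_, _, _, _); lia.
Qed.

Lemma rc_root_add (V : nmodType) (al : 4.-tuple V) m k :
  rc_root al (rc_add m k) = rc_root al m + rc_root al k.
Proof.
rewrite /rc_root /natcomb -big_split; apply: eq_bigr => i _ /=.
by rewrite !tnth_rc_tuple rc_coord_add mulrnDr.
Qed.

Lemma rc_root_single (V : nmodType) (al : 4.-tuple V) (j : 'I_4) n :
  rc_root al (rc_single j n) = tnth al j *+ n.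
Proof.
rewrite /rc_root /natcomb (bigD1 j) //= big1 => [|i /negPf neq_ij].
  by rewrite addr0 tnth_rc_tuple rc_coord_single eqxx mul1n.
by rewrite tnth_rc_tuple rc_coord_single neq_ij.
Qed.

Section F4.
Variables (K : numFieldType) (L : vectType K) (br : lieBracket L).
Variables (T : {vspace L}) (al : 4.-tuple 'Hom(subvs_of T, K^o)).
Hypothesis cartanT : cartan_subalgebra br T.
Hypothesis simple_al : simple_roots br al.
Hypothesis typeL : type_F4 br al.

Local Notation wt := (rc_root al).
Local Notation rsp m := (root_space br (wt m)).

Lemma natcomb_eval (k : 4.-tuple nat) t :
  natcomb al k t = \sum_(i < 4) (tnth al i t : K) *+ tnth k i :> K.
Proof. by rewrite sum_lfunE; apply: eq_bigr => i _; rewrite hom_Mn. Qed.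

Lemma F4_sl2 : exists h : 'I_4 -> subvs_of T,
  (forall m (j : 'I_4), wt m (h j) = (F4_pairing m j)%:~R :> K) /\
  (forall j, exists e f, sl2_triple br (tnth al j) e f (h j)).
Proof.
have [h [h_coroot al_h]] := typeL; exists h; split=> [m j|j]; last first.
  exact: is_coroot_sl2.
rewrite natcomb_eval (eq_bigr (fun i => (cartanF4 i j *+ rc_coord m i)%:~R)).
  rewrite -rmorph_sum; congr (_%:~R); case: m => [[[a b] c] d].
  case: j => [[|[|[|[|//]]]] j4]; rewrite !big_ord_recl big_ord0 /=;
    rewrite /cartanF4 /=; lia.
by move=> i _; rewrite al_h tnth_rc_tuple rmorphMn.
Qed.

(** Fundamental coweights, which read off the coordinates of a weight. The Cartan matrix has
    determinant 1, so they are integral combinations of the coroots. *)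
Lemma F4_coweights : exists w : 'I_4 -> subvs_of T,
  forall k j, natcomb al k (w j) = (tnth k j)%:R :> K.
Proof.
have [h [_ al_h]] := typeL.
(* The inverse of the Cartan matrix. *)
pose C (i j : nat) : nat := nth 0%N (nth [::] [:: [:: 2; 3; 4; 2]; [:: 3; 6; 8; 4];
  [:: 2; 4; 6; 3]; [:: 1; 2; 3; 2]]%N i) j.
exists (fun j => \sum_k h k *+ C k j) => k j.
have al_w i : tnth al i (\sum_k h k *+ C k j) = (i == j)%:R :> K.
  rewrite linear_sum (eq_bigr (fun k : 'I_4 => (cartanF4 i k *+ C k j)%:~R : K)).
    rewrite -rmorph_sum -[RHS]/(((i == j)%:Z)%:~R); congr (_%:~R).
    case: i j => [[|[|[|[|//]]]] i4] [[|[|[|[|//]]]] j4];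
      by rewrite !big_ord_recl big_ord0 /cartanF4 /C -val_eqE.
  by move=> l _; rewrite linearMn /= al_h rmorphMn.
rewrite natcomb_eval; under eq_bigr do rewrite al_w.
rewrite (bigD1 j) //= eqxx big1 ?addr0 // => i /negPf ->.
by rewrite mul0rn.
Qed.

Lemma rc_root_coord (w : 'I_4 -> subvs_of T) m j :
  (forall k j, natcomb al k (w j) = (tnth k j)%:R :> K) ->
  wt m (w j) = (rc_coord m j)%:R :> K.
Proof. by move=> al_w; rewrite al_w tnth_rc_tuple. Qed.

Lemma rc_root_inj : injective wt.
Proof.
have [w al_w] := F4_coweights => m k eq_mk; apply: rc_coord_inj => j.
have := congr1 (fun f : 'Hom(subvs_of T, K^o) => f (w j) : K) eq_mk.
by rewrite !rc_root_coord // => /eqP; rewrite eqr_nat => /eqP.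
Qed.

Lemma rc_root_neq0 m : m != rc0 -> wt m != 0.
Proof.
apply: contraNneq => m0; apply/eqP/rc_root_inj; rewrite m0 /rc_root /natcomb.
by rewrite big1 // => i _; rewrite tnth_rc_tuple /=; case: i => [[|[|[|[|//]]]] i4].
Qed.

(** Induction on height: reflecting in a simple root of positive pairing keeps the dimension, and
    lowers the height as long as the coordinates stay nonnegative. Otherwise [m] is a multiple of
    that simple root, or its reflection has coordinates of both signs and is not a root. *)
Lemma F4_root_dim (m : rootc) : m != rc0 -> \dim (rsp m) = (m \in F4_roots) :> nat.
Proof.
have [h [al_h sl2]] := F4_sl2.
have [w al_w] := F4_coweights.
have [n] := ubnP (rc_height m); elim: n m => // n IHn m lt_n m0.
have [j0 j4 p_gt0] := F4_pairing_gt0 m0; pose j := Ordinal j4.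
have [e [f sl2_j]] := sl2 j.
pose p := `|F4_pairing m j|%N; have p0 : (0 < p)%N by rewrite /p /=; lia.
have mh : wt m (h j) = p%:R :> K.
  by rewrite al_h -[p%:R]/(p%:~R) /p /= gtz0_abs.
have dim_m := sl2_dim_eq sl2_j mh.
have [le_p|gt_p] := leqP p (rc_coord m j).
  have mE := rc_add_sub le_p; set m' := rc_sub m _ in mE.
  have m'_wt : wt m - tnth al j *+ p = wt m'.
    by rewrite -{1}mE rc_root_add rc_root_single addrK.
  rewrite dim_m m'_wt IHn.
  - by rewrite /m' F4_reflect.
  - rewrite -ltnS; apply: leq_trans lt_n; rewrite ltnS -mE.
    case: (m') (j) => [[[a b] c] d] [[|[|[|[|//]]]] ?] /=; lia.
  (* If the reflection were 0, [m] would be [p] times the simple root, whose pairing is 2p instead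
     of [p]. *)
  have pE : `|F4_pairing (rc_single j p) j|%N = p.*2.
    by case: (j) => [[|[|[|[|//]]]] ?] /=; lia.
  apply: contraTneq p0 => m'0; move: mE; rewrite m'0 => mE.
  have {}mE : m = rc_single j p.
    by rewrite -mE; case: (j) => [[|[|[|[|//]]]] ?].
  by move: pE; rewrite -{1}mE -/p; lia.
have [mE|m_neq] := eqVneq m (rc_single j (rc_coord m j)).
  rewrite mE rc_root_single; case: (rc_coord m j) mE => [|[|c]] mE.
  - by case/eqP: m0; rewrite mE; case: (j) => [[|[|[|[|//]]]] ?].
  - have [/(_ j)[_ aj0] _ _] := simple_al.
    rewrite mulr1n; move: aj0; rewrite (sl2_dim1 sl2_j cartanT) dim_vline.
    rewrite -dimv_eq0 dim_vline eqb0 negbK => ->.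
    by case: (j) => [[|[|[|[|//]]]] ?].
  rewrite (sl2_multiple sl2_j _ cartanT) dimv0.
  by case: (j) c {mE} => [[|[|[|[|//]]]] ?] [|[|[|c]]].
have -> : m \in F4_roots = false.
  apply: contraNF m_neq => /(F4_reflect_neg j4) => mE.
  have {}mE : m = rc_single j 1 by apply: mE; move: gt_p; rewrite /p /=; lia.
  by rewrite {2}mE rc_coord_single eqxx muln1 -mE.
(* The [j]-th coordinate of [b] is negative, so [b] would be minus a nonnegative combination. Its
   other coordinates are those of [m], hence all zero, against [m_neq]. *)
apply/eqP; rewrite dim_m dimv_eq0; apply: contraT => root_b.
set b := wt m - _ in root_b.
have b_w i : b (w i) = (rc_coord m i)%:R - ((i == j) * p)%:R :> K.
  by rewrite /b -rc_root_single lfun_simp opp_lfunE !rc_root_coord // rc_coord_single.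
have [_ _ /(_ b)[|k [bk|bk]]] := simple_al.
- split=> //; apply: contraTneq gt_p => b0.
  move/eqP: (b_w j); rewrite b0 lfun_simp eqxx mul1n eq_sym subr_eq0 eqr_nat.
  by move/eqP->; rewrite ltnn.
- move/eqP: (b_w j); rewrite bk al_w eqxx mul1n eq_sym subr_eq -natrD eqr_nat.
  by move/eqP=> mj; move: gt_p; rewrite mj ltnNge leq_addl.
case/eqP: m_neq; apply: rc_coord_inj => i; rewrite rc_coord_single.
have [->|neq_ij] := eqVneq i j; first by rewrite mul1n.
move/eqP: (b_w i); rewrite bk opp_lfunE al_w (negPf neq_ij) mul0n subr0.
rewrite eq_sym -addr_eq0 -natrD pnatr_eq0 addn_eq0 => /andP[/eqP-> _].
by rewrite mul0n.
Qed.

End F4.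

Lemma rc_addC m k : rc_add m k = rc_add k m.
Proof.
by case: m k => [[[a b] c] d] [[[a' b'] c'] d'] /=; congr (_, _, _, _); apply: addnC.
Qed.

Lemma rc_addAC m k l : rc_add (rc_add m k) l = rc_add (rc_add m l) k.
Proof.
by case: m k l => [[[a b] c] d] [[[a' b'] c'] d'] [[[a1 b1] c1] d1] /=;
   congr (_, _, _, _); apply: addnAC.
Qed.

(** Base 5 digits: coordinates of roots are at most 4, so the codes of the roots are distinct and
    nonzero. They serve as eigenvalues of one element of [T] separating all root lines and [T]. *)
Definition rc_code (m : rootc) : nat :=
  let: (a, b, c, d) := m in (a + 5 * b + 25 * c + 125 * d)%N.

(** * Brackets of root vectors and the abelian ideals of the Borel subalgebra *)

Section F4RootVectors.
Variables (K : numFieldType) (L : vectType K) (br : lieBracket L).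
Variables (T : {vspace L}) (al : 4.-tuple 'Hom(subvs_of T, K^o)).
Hypothesis simpleL : lie_simple br.
Hypothesis cartanT : cartan_subalgebra br T.
Hypothesis simple_al : simple_roots br al.
Hypothesis typeL : type_F4 br al.
Variable X : rootc -> L.
Hypothesis rootX : forall m, is_root br (rc_root al m) ->
  root_vector br (rc_root al m) (X m).

Local Notation wt := (rc_root al).
Local Notation rsp m := (root_space br (wt m)).

Lemma F4_root_neq0 m : m \in F4_roots -> m != rc0.
Proof. by apply: contraTneq => ->. Qed.

Lemma F4_is_root m : m \in F4_roots -> is_root br (wt m).
Proof.
move=> m_root; have m0 := F4_root_neq0 m_root; split.
  exact: (rc_root_neq0 typeL).
by rewrite -dimv_eq0 (F4_root_dim cartanT simple_al typeL) ?m_root.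
Qed.

Lemma F4_rootX m : m \in F4_roots -> X m \in rsp m /\ X m != 0.
Proof. by move/F4_is_root/rootX. Qed.

Lemma F4_root_line m : m \in F4_roots -> rsp m = <[X m]>%VS.
Proof.
move=> m_root; have [Xm Xm0] := F4_rootX m_root.
apply/esym/eqP; rewrite eqEdim -memvE Xm dim_vline Xm0.
by rewrite (F4_root_dim cartanT simple_al typeL) ?F4_root_neq0 // m_root.
Qed.

Lemma F4_nonroot m : m != rc0 -> m \notin F4_roots -> rsp m = 0%VS.
Proof.
move=> m0 /negPf not_root; apply/eqP; rewrite -dimv_eq0.
by rewrite (F4_root_dim cartanT simple_al typeL) // not_root.
Qed.

Lemma F4_br_mem m k : m \in F4_roots -> k \in F4_roots ->
  br (X m) (X k) \in rsp (rc_add m k).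
Proof.
move=> /F4_rootX[Xm _] /F4_rootX[Xk _].
by rewrite rc_root_add root_space_br.
Qed.

Lemma F4_br_nonroot m k : m \in F4_roots -> k \in F4_roots ->
  rc_add m k \notin F4_roots -> br (X m) (X k) = 0.
Proof.
move=> m_root k_root mk; have := F4_br_mem m_root k_root.
rewrite F4_nonroot // ?memv0; first by move/eqP.
apply: contraNneq (F4_root_neq0 m_root).
by case: m k {m_root k_root mk} => [[[a b] c] d] [[[a' b'] c'] d'] [] /= *;
   apply/eqP; congr (_, _, _, _); lia.
Qed.

Lemma F4_br_simple m j : (j < 4)%N -> m \in F4_roots ->
  rc_add m (rc_single j 1) \in F4_roots ->
  exists2 c : K, c != 0 &
    br (X (rc_single j 1)) (X m) = c *: X (rc_add m (rc_single j 1)).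
Proof.
move=> j4 m_root mj_root; have j_root : rc_single j 1 \in F4_roots.
  by case: j j4 {mj_root} => [|[|[|[|//]]]].
have [h [al_h sl2]] := F4_sl2 cartanT typeL; have [e [f sl2_j]] := sl2 (Ordinal j4).
have [Xm Xm0] := F4_rootX m_root.
have : br (X (rc_single j 1)) (X m) \in <[X (rc_add m (rc_single j 1))]>%VS.
  by rewrite -F4_root_line // rc_addC F4_br_mem.
case/vlineP => c brE; exists c => //.
have dim1 : \dim (rsp m) = 1%N.
  by rewrite (F4_root_dim cartanT simple_al typeL) ?F4_root_neq0 ?m_root.
have mjE : wt (rc_add m (rc_single j 1)) = wt m + tnth al (Ordinal j4).
  by rewrite rc_root_add -[tnth al _]mulr1n -rc_root_single.
have := sl2_raise_neq0 sl2_j (al_h m _) dim1 _ Xm Xm0.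
rewrite -mjE => /(_ (F4_is_root mj_root).2).
(* The vector [e] is a multiple of the chosen simple root vector, so c = 0 would make it kill
   [X m]. *)
apply: contraNneq => c0; have [e_al _ _ _] := sl2_j.
have : e \in <[X (rc_single j 1)]>%VS.
  by rewrite -F4_root_line // (rc_root_single al (Ordinal j4)) mulr1n.
by case/vlineP => d ->; rewrite lieZl brE c0 scale0r scaler0.
Qed.

(** Induction on the height of [m], down to the first simple root. With m = m' + a_j and m' + k not
    a root, the Jacobi identity moves a_j from [m] over to [k], up to nonzero scalars. *)
Lemma F4_br_highest m k : m \in F4_roots -> k \in F4_roots ->
  rc_add m k = F4_highest -> br (X m) (X k) != 0.
Proof.
have [n] := ubnP (rc_height m); elim: n m k => // n IHn m k lt_n m_root k_root mk.
have [mE|m_neq] := eqVneq m (rc_single 0 1).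
  have mk_root : rc_add k (rc_single 0 1) \in F4_roots by rewrite -mE rc_addC mk.
  have [c c0] := F4_br_simple (isT : (0 < 4)%N) k_root mk_root.
  rewrite -mE => ->; rewrite scaler_eq0 negb_or c0 rc_addC mk.
  by case: (@F4_rootX F4_highest).
have [m' [j [/andP[j0 j4] m'_root m_E kj_root m'k]]] :=
  F4_highest_pair m_root k_root mk m_neq.
have m_root' : rc_add m' (rc_single j 1) \in F4_roots by rewrite -m_E.
have [c c0 brm] := F4_br_simple j4 m'_root m_root'.
have [d d0 brk] := F4_br_simple j4 k_root kj_root.
have j_root : rc_single j 1 \in F4_roots by case: (j) j4 => [|[|[|[|//]]]].
have brE : c *: br (X m) (X k) = - d *: br (X m') (X (rc_add k (rc_single j 1))).
  rewrite m_E -lieZl -brm scaleNr -lieZr -brk.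
  have := lieA br (X (rc_single j 1)) (X m') (X k).
  rewrite (F4_br_nonroot m'_root k_root m'k) lie0r => /esym/eqP.
  by rewrite addr_eq0 => /eqP.
have: c *: br (X m) (X k) != 0.
  rewrite brE scaler_eq0 oppr_eq0 (negPf d0) IHn //.
    rewrite -ltnS; apply: leq_trans lt_n; rewrite ltnS m_E.
    by case: (m') (j) => [[[a b] c'] d'] [|[|[|?]]] /=; lia.
  by rewrite -mk m_E [RHS]rc_addAC [LHS]rc_addC [LHS]rc_addAC (rc_addC k).
by rewrite scaler_eq0 negb_or => /andP[].
Qed.

Lemma F4_borel : borel br al = (T + <<map X F4_roots>>)%VS.
Proof.
congr (_ + _)%VS.
have -> : pos_roots br al = [set` map wt F4_roots]%classic.
  apply/seteqP; split=> b.
    case=> b_root [k bk]; pose m := (tnth k (inord 0), tnth k (inord 1),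
      tnth k (inord 2), tnth k (inord 3)).
    have kE : k = rc_tuple m.
      apply: eq_from_tnth => i; rewrite tnth_rc_tuple; case: i => [[|[|[|[|//]]]] i4] /=;
      by congr tnth; apply: val_inj; rewrite /= inordK.
    have bm : b = wt m by rewrite bk kE.
    apply: (introT mapP); exists m => //; case: b_root; rewrite bm => wm0 rm0.
    have m0 : m != rc0.
      apply: contraNneq wm0 => ->; rewrite /rc_root /natcomb big1 // => i _.
      by rewrite tnth_rc_tuple; case: i => [[|[|[|[|//]]]] i4].
    by apply: contraNT rm0 => /(F4_nonroot m0) ->.
  move/mapP => [m m_root ->]; split; first exact: F4_is_root.
  by exists (rc_tuple m).
rewrite -fsbig_seq; last by rewrite map_inj_uniq //; apply: (rc_root_inj typeL).
rewrite big_map span_def big_map; apply: eq_big_seq => m; exact: F4_root_line.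
Qed.

Lemma F4_rc_code : exists t : subvs_of T,
  forall m, wt m t = (rc_code m)%:R :> K.
Proof.
have [w al_w] := F4_coweights typeL; exists (\sum_j w j *+ 5 ^ j) => m.
rewrite linear_sum (eq_bigr (fun j : 'I_4 => (rc_coord m j * 5 ^ j)%:R : K)).
  rewrite -natr_sum; congr (_%:R); case: m => [[[a b] c] d].
  rewrite !big_ord_recl big_ord0 /= /bump /= !expnS expn0; lia.
by move=> j _; rewrite linearMn /= (rc_root_coord _ _ al_w) -mulrnA.
Qed.

Lemma F4_components (I : {vspace L}) t (y : rootc -> L) :
  (forall s x, s \in T -> x \in I -> br s x \in I) -> t \in T ->
  (forall m, m \in F4_roots -> y m \in <[X m]>%VS) ->
  t + \sum_(m <- F4_roots) y m \in I ->
  t \in I /\ forall m, m \in F4_roots -> y m \in I.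
Proof.
move=> stabI tT yX sumI; have [t0 code_t0] := F4_rc_code.
(* [None] indexes the component in [T], of eigenvalue 0. *)
pose v (o : option rootc) := if o is Some m then y m else t.
pose lam (o : option rootc) : K := if o is Some m then (rc_code m)%:R else 0.
have comp o : o \in None :: map Some F4_roots -> v o \in I.
  apply: (@eigen_components _ _ (lie_ad br (vsval t0)) I _ _ lam).
  - by move=> x xI; rewrite lie_adE stabI ?subvsP.
  - have -> : [seq lam j | j <- None :: map Some F4_roots]
        = [seq (n%:R : K) | n <- 0%N :: map rc_code F4_roots].
      by [].
    by rewrite map_inj_uniq // => a b /eqP; rewrite eqr_nat => /eqP.
  - case=> [m|_]; last first.
      by rewrite /= lie_adE scale0r; case: cartanT => abT _ _; rewrite abT ?subvsP.
    rewrite in_cons => /mapP[k k_root [mk]] /=.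
    have m_root : m \in F4_roots by rewrite mk.
    rewrite lie_adE; have := yX m m_root; rewrite -F4_root_line //.
    by move/root_spaceP => ->; rewrite code_t0.
  - by rewrite big_cons big_map.
split=> [|m m_root]; first exact: (comp None (mem_head _ _)).
by apply: (comp (Some m)); rewrite in_cons map_f.
Qed.

(** Root vectors for distinct roots are independent: otherwise -X_m plus its expansion over [A]
    would be a vanishing sum of eigenvectors with distinct eigenvalues. *)
Lemma F4_span_mem A m : uniq A -> {subset A <= F4_roots} -> m \in F4_roots ->
  X m \in <<map X A>>%VS -> m \in A.
Proof.
move=> uniq_A sub_A m_root XmA; apply: contraT => m_A.
have [y yX XmE] := span_map_sum uniq_A XmA.
have [t0 code_t0] := F4_rc_code.
pose v k := if k == m then - X m else y k.
have : v m \in (0%VS : {vspace L}).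
  apply: (@eigen_components _ _ (lie_ad br (vsval t0)) 0%VS _ (m :: A)
    (fun m => (rc_code m)%:R)); last exact: mem_head.
  - by move=> x; rewrite memv0 => /eqP->; rewrite linear0 mem0v.
  - rewrite (map_comp (fun n => n%:R) rc_code) map_inj_uniq; last first.
      by move=> a b /eqP; rewrite eqr_nat => /eqP.
    rewrite map_inj_in_uniq /= ?m_A // => a b a_A b_A.
    have code_inj : all (fun a => all (fun b => (rc_code a == rc_code b) ==> (a == b))
      F4_roots) F4_roots by vm_compute.
    have sub k : k \in m :: A -> k \in F4_roots.
      by rewrite inE => /predU1P[-> //|/sub_A].
    move/eqP; move: (allP (allP code_inj a (sub a a_A)) b (sub b b_A)).
    by move/implyP => ab /ab /eqP.
  - move=> k kA; have k_root : k \in F4_roots.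
      by move: kA; rewrite inE => /predU1P[-> //|/sub_A].
    rewrite lie_adE -code_t0; suff /root_spaceP -> : v k \in rsp k by [].
    rewrite F4_root_line // /v.
    case: eqP => [->|/eqP neq_km]; first by rewrite memvN memv_line.
    by apply: yX; move: kA; rewrite inE (negPf neq_km).
  - rewrite big_cons {1}/v eqxx (eq_big_seq y) => [|k kA].
      by rewrite -XmE addNr mem0v.
    by rewrite /v; case: eqP => // km; rewrite -km kA in m_A.
rewrite /v eqxx memv0 oppr_eq0; case: (F4_rootX m_root) => _ /negPf -> //.
Qed.

Lemma F4_spans_uniq :
  uniq [seq <<map X A>>%VS | A <- [::] :: F4_abelian_ideals].
Proof.
rewrite map_inj_in_uniq => [|A B A_ideal B_ideal eqAB]; first by vm_compute.
have [uA subA _ _] := F4_abelian_idealsP A_ideal.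
have [uB subB _ _] := F4_abelian_idealsP B_ideal.
apply: F4_abelian_ideals_eq => // m; apply/idP/idP => [mA|mB].
  by apply: F4_span_mem (subA m mA) _ => //; rewrite -eqAB memv_span ?map_f.
by apply: F4_span_mem (subB m mB) _ => //; rewrite eqAB memv_span ?map_f.
Qed.

Lemma F4_span_ideal A : A \in [::] :: F4_abelian_ideals ->
  lie_ideal br (borel br al) <<map X A>>%VS /\ lie_abelian br <<map X A>>%VS.
Proof.
move=> /F4_abelian_idealsP[_ subA closedA abelA]; split; last first.
  move=> x y xA yA; apply/eqP; rewrite -memv0.
  apply: (@lie_span_sub _ _ br) xA yA => _ _ /mapP[m mA ->] /mapP[k kA ->].
  by rewrite (F4_br_nonroot (subA m mA) (subA k kA) (abelA m k mA kA)) mem0v.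
rewrite F4_borel; split.
  apply: subv_trans (addvSr _ _); apply/span_subvP => _ /mapP[m mA ->].
  by rewrite memv_span // map_f // subA.
rewrite -(span_basis (vbasisP T)) -span_cat => x y; apply: lie_span_sub.
move=> {}x _ + /mapP[k kA ->]; have k_root := subA k kA; have XkA := map_f X kA.
rewrite mem_cat => /orP[/vbasis_mem xT|/mapP[m m_root ->]].
  by rewrite (root_space_cartan xT (F4_rootX k_root).1) memvZ // memv_span.
have [mk_root|mk] := boolP (rc_add m k \in F4_roots); last first.
  by rewrite F4_br_nonroot ?mem0v.
have := F4_br_mem m_root k_root; rewrite F4_root_line // => /vlineP[c ->].
by rewrite memvZ // memv_span // map_f // closedA.
Qed.

Lemma F4_ideal_span (I : {vspace L}) :
  lie_ideal br (borel br al) I -> lie_abelian br I ->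
  exists2 A, A \in [::] :: F4_abelian_ideals & I = <<map X A>>%VS.
Proof.
rewrite F4_borel => -[I_g stabI] abI.
have Tg t : t \in T -> t \in (T + <<map X F4_roots>>)%VS.
  by rewrite !memvE => /subv_trans; apply; apply: addvSl.
have Xg m : m \in F4_roots -> X m \in (T + <<map X F4_roots>>)%VS.
  move=> m_root; apply: (subvP (addvSr _ _)).
  by rewrite memv_span // map_f.
(* Both [t] and [t, X_m] lie in the abelian ideal, so [t, [t, X_m]] = 0. For a simple root this says
   that the square of its value at [t] is 0; hence all roots vanish at [t]. *)
have I_T t : t \in T -> t \in I -> t = 0.
  move=> tT tI; apply: (cartan_faithful simpleL cartanT) => // b b_root.
  have al_t j : tnth al j (vsproj T t) = 0.
    pose m := rc_single j 1.
    have m_root : m \in F4_roots by case: (j) @m => [[|[|[|[|//]]]] ?].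
    have [Xm Xm0] := F4_rootX m_root.
    have tX := root_space_cartan tT Xm.
    have : br t (br t (X m)) = 0.
      apply: abI => //; rewrite lieC -scaleN1r memvZ //; apply: stabI => //.
      exact: Xg.
    rewrite tX lieZr tX scalerA => /eqP; rewrite scaler_eq0 (negPf Xm0) orbF.
    by rewrite mulf_eq0 orbb /m rc_root_single => /eqP.
  have natcomb0 k : natcomb al k (vsproj T t) = 0.
    by rewrite natcomb_eval big1 // => j _; rewrite al_t mul0rn.
  have [_ _ /(_ b b_root)[k [->|->]]] := simple_al; first exact: natcomb0.
  by rewrite opp_lfunE natcomb0 oppr0.
pose P m := X m \in I.
exists [seq m <- F4_roots | P m].
  apply: F4_candidatesP => [m j j4 m_root mj_root Pm|m k m_root k_root mk Pm].
    have j_root : rc_single j 1 \in F4_roots by case: (j) j4 => [|[|[|[|//]]]].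
    have [c c0 brE] := F4_br_simple j4 m_root mj_root.
    have := stabI _ _ (Xg _ j_root) Pm; rewrite brE => /(memvZ c^-1).
    by rewrite scalerA mulVf // scale1r.
  apply/negP => Pk; have := F4_br_highest m_root k_root mk.
  by rewrite abI ?eqxx.
apply/eqP; rewrite eqEsubv; apply/andP; split; last first.
  by apply/span_subvP => _ /mapP[m + ->]; rewrite mem_filter => /andP[].
apply/subvP => x xI; have /memv_addP[t tT [u uX xE]] := subvP I_g x xI.
have [y yX uE] := span_map_sum (isT : uniq F4_roots) uX.
(* Every component of [x] lies in [I]: the one in [T] vanishes by [I_T], and a nonzero root
   component puts its root vector in [I]. *)
have [|tI yI] := @F4_components I t y (fun s z sT => stabI s z (Tg s sT)) tT yX.
  by rewrite -uE -xE.
rewrite xE (I_T t) // add0r uE big_seq; apply: memv_suml => m m_root.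
have /vlineP[c yE] := yX m m_root; have := yI m m_root; rewrite yE => cI.
have [->|c0] := eqVneq c 0; first by rewrite scale0r mem0v.
rewrite memvZ // memv_span // map_f // mem_filter m_root andbT /P.
by move/(memvZ c^-1): cI; rewrite scalerA mulVf // scale1r.
Qed.

End F4RootVectors.

Local Close Scope ring_scope.

Theorem mainTheorem4 (R : realType) (L : vectType R[i]) (br : lieBracket L)
  (T : {vspace L}) (al : 4.-tuple 'Hom(subvs_of T, R[i]^o))
  (X : nat -> nat -> nat -> nat -> L)
  (simpleL : lie_simple br)
  (cartanT : cartan_subalgebra br T)
  (simple_al : simple_roots br al)
  (typeL : type_F4 br al)
  (rootX : forall a b c d : nat,
     is_root br (natcomb al [tuple a; b; c; d]) ->
     root_vector br (natcomb al [tuple a; b; c; d]) (X a b c d)) :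
  let g := borel br al in
  let ideals : seq {vspace L} := 0%VS :: [seq <<s>>%VS | s <- [::
    [:: X 2 3 4 2];
    [:: X 1 3 4 2; X 2 3 4 2];
    [:: X 1 2 4 2; X 1 3 4 2; X 2 3 4 2];
    [:: X 1 2 3 2; X 1 2 4 2; X 1 3 4 2; X 2 3 4 2];
    [:: X 1 2 2 2; X 1 2 3 2; X 1 2 4 2; X 1 3 4 2; X 2 3 4 2];
    [:: X 1 2 3 1; X 1 2 3 2; X 1 2 4 2; X 1 3 4 2; X 2 3 4 2];
    [:: X 1 1 2 2; X 1 2 2 2; X 1 2 3 2; X 1 2 4 2; X 1 3 4 2;
        X 2 3 4 2];
    [:: X 1 2 2 2; X 1 2 3 1; X 1 2 3 2; X 1 2 4 2; X 1 3 4 2;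
        X 2 3 4 2];
    [:: X 0 1 2 2; X 1 1 2 2; X 1 2 2 2; X 1 2 3 2; X 1 2 4 2;
        X 1 3 4 2; X 2 3 4 2];
    [:: X 1 1 2 2; X 1 2 2 2; X 1 2 3 1; X 1 2 3 2; X 1 2 4 2;
        X 1 3 4 2; X 2 3 4 2];
    [:: X 1 2 2 1; X 1 2 2 2; X 1 2 3 1; X 1 2 3 2; X 1 2 4 2;
        X 1 3 4 2; X 2 3 4 2];
    [:: X 1 2 2 0; X 1 2 2 1; X 1 2 2 2; X 1 2 3 1; X 1 2 3 2;
        X 1 2 4 2; X 1 3 4 2; X 2 3 4 2];
    [:: X 0 1 2 2; X 1 1 2 2; X 1 2 2 2; X 1 2 3 1; X 1 2 3 2;
        X 1 2 4 2; X 1 3 4 2; X 2 3 4 2];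
    [:: X 1 1 2 2; X 1 2 2 1; X 1 2 2 2; X 1 2 3 1; X 1 2 3 2;
        X 1 2 4 2; X 1 3 4 2; X 2 3 4 2];
    [:: X 0 1 2 2; X 1 1 2 2; X 1 2 2 1; X 1 2 2 2; X 1 2 3 1;
        X 1 2 3 2; X 1 2 4 2; X 1 3 4 2; X 2 3 4 2]]] in
  [/\ size ideals = 16,
      uniq ideals &
      forall I : {vspace L},
        lie_ideal br g I /\ lie_abelian br I <-> I \in ideals].
Proof.
move=> g ideals.
pose Xr (m : rootc) := let: (a, b, c, d) := m in X a b c d.
have rootXr m : is_root br (rc_root al m) -> root_vector br (rc_root al m) (Xr m).
  by case: m => [[[a b] c] d]; apply: rootX.
(* The zero ideal is the span of the empty set; the remaining entries agree by computation. *)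
have idealsE :
    ideals = [seq <<map Xr A>>%VS | A <- [::] :: F4_abelian_ideals].
  by rewrite map_cons span_nil.
split; first by [].
  by rewrite idealsE; apply: (F4_spans_uniq cartanT simple_al typeL rootXr).
move=> I; rewrite idealsE; split=> [[idealI abI]|/mapP[A A_ideal ->]].
  have [A A_ideal ->] :=
    F4_ideal_span simpleL cartanT simple_al typeL rootXr idealI abI.
  exact: (map_f (fun A => <<map Xr A>>%VS) A_ideal).
exact: (F4_span_ideal cartanT simple_al typeL rootXr).
Qed.
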